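(* Let $N \in \mathbb{N}$, $\gamma > 0$, $\beta \in (0,\infty]$ and $k \in \mathbb{N}$ (with $k \ge 1$). For Lebesgue-almost all $f \in \mathbb{R}^N$, the minimizing signal $u^*$ of the problem $(P_{k,\beta,\gamma})$ with data $f$ is unique; that is, whenever $(u^*,\mathcal{I}^* )$ and $(v^*,\mathcal{J}^* )$ are both minimizers of $(P_{k,\beta,\gamma})$ for the data $f$, then $u^* = v^*$.
   Context: Let $\Omega = \{1,\dots,N\}$. A partition $\mathcal{I}$ of $\Omega$ means a partition of $\Omega$ into (nonempty) discrete intervals $\{l,l+1,\dots,r\}$, $1\le l\le r\le N$; $|\mathcal{I}|$ is its number of intervals. For $u\in\mathbb{R}^N$ and an interval $I=\{l,\dots,r\}$, $u_I=(u_l,\dots,u_r)\in\mathbb{R}^{|I|}$. For $v\in\mathbb{R}^q$ with $q>k$, $\nabla^k v\in\mathbb{R}^{q-k}$ is the $k$-th order finite difference $(\nabla^k v)_i=\sum_{j=0}^k(-1)^{k-j}\binom{k}{j}v_{i+j}$, $i=1,\dots,q-k$; for $q\le k$, $\nabla^k v$ is the empty vector, so $\|\nabla^k v\|_2^2=0$. For $\beta\in(0,\infty)$, the higher order Mumford-Shah problem $(P_{k,\beta,\gamma})$ with data $f$ is to minimize $$\|u-f\|_2^2+\sum_{I\in\mathcal{I}}\beta^{2k}\|\nabla^k u_I\|_2^2+\gamma|\mathcal{I}|$$ over all pairs $(u,\mathcal{I})$ with $u\in\mathbb{R}^N$ and $\mathcal{I}$ a partition of $\Omega$. For $\beta=\infty$,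 the higher order Potts problem $(P_{k,\infty,\gamma})$ is to minimize $\|u-f\|_2^2+\gamma|\mathcal{I}|$ over all pairs $(u,\mathcal{I})$ with $u\in\mathbb{R}^N$, $\mathcal{I}$ a partition of $\Omega$, and such that for every $I\in\mathcal{I}$ the vector $u_I$ is a polynomial of degree at most $k-1$ (i.e. there is a real polynomial $p$ of degree at most $k-1$ with $u_n=p(n)$ for all $n\in I$). *)

(* Defs.v *)
(* The reals are an arbitrary [R : realType] of MathComp-Analysis.
   Vectors of R^N are [N.-tuple R]; vectors of unspecified length are [seq R].
   Indices are 0-based: [i : 'I_N] stands for the point i + 1 of {1, ..., N}. *)
From HB Require Import structures.
From mathcomp Require Import all_boot all_order all_algebra.
From mathcomp Require Import all_classical all_reals all_analysis.

Set Implicit Arguments.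
Unset Strict Implicit.
Unset Printing Implicit Defensive.

Import Order.TTheory GRing.Theory Num.Theory.
Import numFieldNormedType.Exports.

Local Open Scope ring_scope.

Section lebesgue_tuple.
Variable R : realType.

Definition cons_pair n (p : R * n.-tuple R) : n.+1.-tuple R :=
  [tuple of p.1 :: p.2].

(* The n-dimensional Lebesgue measure on the Borel sets of R^n, as an iterated
   product.  Negligibility in the library's [\forall f \ae mu, P f] means being
   contained in a measurable set of measure 0, so completing the measure would
   not change the meaning of "almost all". *)
Fixpoint lebesgue_tuple n : set (n.-tuple R) -> \bar R :=
  match n with
  | 0 => \d_[tuple]
  | n'.+1 => pushforward (@lebesgue_measure R \x @lebesgue_tuple n')%E
               (@cons_pair n')
  end.

Lemma measurable_cons_pair n : measurable_fun setT (@cons_pair n).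
Proof. exact: measurable_cons. Qed.

Lemma lebesgue_tuple_sigma_finite_measure n :
  exists mu : {sigma_finite_measure set (n.-tuple R) -> \bar R},
    @lebesgue_tuple n = mu.
Proof.
elim: n => [|n [mu muE]].
  by exists \d_[tuple].
pose m := (@lebesgue_measure R \x mu)%E.
have mc := @measurable_cons_pair n.
have ms : sigma_finite setT m.
  have /sigma_finiteP[F [FT ndF Foo]] := sigma_finiteT (@lebesgue_measure R).
  have /sigma_finiteP[G [GT ndG Goo]] := sigma_finiteT mu.
  exists (fun i => F i `*` G i)%classic.
    rewrite -setXTT FT GT; apply/seteqP; split=> [[x y] [/= [i _ Fx] [j _ Gy]]|].
      exists (maxn i j) => //; split.
      - by move: x Fx; exact/subsetPset/ndF/leq_maxl.
      - by move: y Gy; exact/subsetPset/ndG/leq_maxr.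
    by move=> [x y] [i _ [/= ? ?]]; split; exists i.
  move=> i; have [mF Fi] := Foo i; have [mG Gi] := Goo i.
  split; first exact: measurableX.
  by rewrite /m product_measure1E// lte_mul_pinfty// ge0_fin_numE.
have nus : sigma_finite setT (pushforward m (@cons_pair n)).
  have [F FT Foo] := ms.
  pose g (t : n.+1.-tuple R) : measurableTypeR R * n.-tuple R :=
    (thead t, [tuple of behead t]).
  have mg : measurable_fun setT g.
    apply/measurable_fun_pairP; split; last exact: measurable_behead.
    exact: measurable_tnth.
  have cg : cancel (@cons_pair n) g.
    by case=> x t; rewrite /g /cons_pair /= theadE; congr pair; exact/val_inj.
  exists (fun i => g @^-1` F i)%classic.
    by rewrite -preimage_bigcup -FT preimage_setT.
  move=> i; have [mF Fi] := Foo i; split.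
    by rewrite -[X in measurable X]setTI; exact: mg.
  rewrite /pushforward -comp_preimage.
  by rewrite (_ : g \o _ = id) ?preimage_id //; apply/funext => x /=; rewrite cg.
pose nu := measure_function_pushforward__canonical__measure_function_Measure m mc.
pose nu_sf := Measure_isSigmaFinite.Build _ _ _ (Measure.sort nu) nus.
exists (HB.pack_for (SigmaFiniteMeasure.type _ R) (Measure.sort nu) nu_sf).
by rewrite /= muE.
Qed.

Let lebesgue_tuple0 n : lebesgue_tuple (n := n) set0 = 0%E.
Proof.
by have [mu ->] := lebesgue_tuple_sigma_finite_measure n; exact: measure0.
Qed.

Let lebesgue_tuple_ge0 n (A : set (n.-tuple R)) : (0 <= lebesgue_tuple A)%E.
Proof. by have [mu ->] := lebesgue_tuple_sigma_finite_measure n. Qed.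

Let lebesgue_tuple_sigma_additive n :
  semi_sigma_additive (lebesgue_tuple (n := n)).
Proof.
have [mu ->] := lebesgue_tuple_sigma_finite_measure n.
exact: measure_semi_sigma_additive.
Qed.

HB.instance Definition _ n := isMeasure.Build _ _ _ (@lebesgue_tuple n)
  (@lebesgue_tuple0 n) (@lebesgue_tuple_ge0 n)
  (@lebesgue_tuple_sigma_additive n).

Let sigma_finite_lebesgue_tuple n : sigma_finite setT (@lebesgue_tuple n).
Proof.
by have [mu ->] := lebesgue_tuple_sigma_finite_measure n; exact: sigma_finiteT.
Qed.

HB.instance Definition _ n := Measure_isSigmaFinite.Build _ _ _
  (@lebesgue_tuple n) (@sigma_finite_lebesgue_tuple n).

Lemma measurable_box n (A : 'I_n -> set R) :
  (forall i, measurable (A i)) ->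
  measurable [set t : n.-tuple R | forall i, A i (tnth t i)]%classic.
Proof.
move=> mA.
rewrite (_ : mkset _ = \bigcap_(i in [set: 'I_n]) ((@tnth n R)^~ i @^-1` A i))%classic.
  apply: fin_bigcap_measurable => // i _.
  by rewrite -[X in measurable X]setTI; exact: measurable_tnth.
by apply/seteqP; split=> t /= tA i; [move=> _|]; exact: tA.
Qed.

Lemma lebesgue_tuple_box n (A : 'I_n -> set R) :
  (forall i, measurable (A i)) ->
  lebesgue_tuple [set t : n.-tuple R | forall i, A i (tnth t i)]%classic =
  (\prod_(i < n) lebesgue_measure (A i))%E.
Proof.
elim: n A => [|n IHn] A mA.
  rewrite big_ord0 /= (_ : mkset _ = setT) ?diracT//.
  by apply/seteqP; split=> // t _ [].
rewrite big_ord_recl -IHn; last by move=> i; exact: mA.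
have mB := measurable_box (fun i => mA (lift ord0 i)).
transitivity ((@lebesgue_measure R \x @lebesgue_tuple n)%E
  (A ord0 `*` [set t : n.-tuple R | forall i, A (lift ord0 i) (tnth t i)])%classic).
  rewrite /= /pushforward; congr (_ _); apply/seteqP; split=> -[x t] /=.
    move=> tA; split; first exact: (tA ord0).
    by move=> i; have := tA (lift ord0 i); rewrite tnthS.
  by move=> [Ax tA] i; have [j|] := unliftP ord0 i => ->; rewrite ?tnthS.
have := product_measure1E (@lebesgue_measure R) (@lebesgue_tuple n) (mA ord0) mB.
by move=> ->.
Qed.

End lebesgue_tuple.

Definition is_interval_set N (I : {set 'I_N}) : Prop :=
  exists l r : 'I_N, (l <= r)%N /\ I = [set i : 'I_N | (l <= i <= r)%N]%SET.

Definition interval_partition N (P : {set {set 'I_N}}) : Prop :=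
  finset.partition P [set: 'I_N]%SET /\ forall I, I \in P -> is_interval_set I.

Section problems.
Variables (R : realType) (N k : nat).
Implicit Types (f u : N.-tuple R) (I : {set 'I_N}) (P : {set {set 'I_N}}).

(* [enum I] lists [I] in increasing order. *)
Definition subvec u I : seq R := [seq tnth u i | i <- enum I].

(* The k-th order finite difference; the truncated subtraction [size v - k]
   makes it empty when [size v <= k]. *)
Definition fdiff (v : seq R) : seq R :=
  mkseq (fun i => \sum_(j < k.+1) (-1) ^+ (k - j) * 'C(k, j)%:R * v`_(i + j))
    (size v - k).

Definition sqnorm (v : seq R) : R := \sum_(x <- v) x ^+ 2.

Definition sqdist u f : R := \sum_(i < N) (tnth u i - tnth f i) ^+ 2.

Definition mumford_shah (beta gamma : R) f u P : R :=
  sqdist u f + \sum_(I in P) beta ^+ (2 * k) * sqnorm (fdiff (subvec u I))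
  + gamma * #|P|%:R.

Definition potts (gamma : R) f u P : R := sqdist u f + gamma * #|P|%:R.

(* [size p <= k] says that [p] has degree at most k - 1 (or is 0). *)
Definition poly_on u I : Prop :=
  exists2 p : {poly R}, (size p <= k)%N &
    forall i, i \in I -> tnth u i = p.[i.+1%:R].

Definition mumford_shah_minimizer beta gamma f u P : Prop :=
  interval_partition P /\
  forall v Q, interval_partition Q ->
    mumford_shah beta gamma f u P <= mumford_shah beta gamma f v Q.

Definition potts_feasible u P : Prop :=
  interval_partition P /\ forall I, I \in P -> poly_on u I.

Definition potts_minimizer gamma f u P : Prop :=
  potts_feasible u P /\
  forall v Q, potts_feasible v Q -> potts gamma f u P <= potts gamma f v Q.

(* [beta] ranges over (0, +oo]; the value at -oo is junk. *)
Definition minimizer (beta : \bar R) gamma f u P : Prop :=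
  match beta with
  | b%:E => mumford_shah_minimizer b gamma f u P
  | +oo%E => potts_minimizer gamma f u P
  | -oo%E => False
  end.

End problems.

(* Main.v *)
(* Fix the partition P. The optimal signal is the minimizer of a penalized
   least squares problem over a linear subspace, so the normal equations give
   u_P = f S_P with S_P a symmetric matrix, and the optimal energy is
   |f|^2 - <f S_P, f> + gamma |P|. If minimizers for P and Q exist, their
   energies agree, so <f (S_P - S_Q), f> = gamma (|P| - |Q|). When S_P = S_Q the
   signals agree; otherwise f lies in a level set of a nonzero quadratic form,
   which is Lebesgue-null. There are finitely many pairs (P, Q). *)
Require Import Defs.
From mathcomp Require Import all_boot all_order all_algebra.
From mathcomp Require Import all_classical all_reals all_analysis.
From mathcomp Require Import measurable_realfun ring lra.
Import Order.TTheory GRing.Theory Num.Theory.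
Local Open Scope ring_scope.
Set Implicit Arguments.
Unset Strict Implicit.
Unset Printing Implicit Defensive.

(** * Bilinear forms on row vectors *)

Section bilinear.
Variables (R : comPzRingType) (n : nat).
Implicit Types (A B : 'M[R]_n) (u v w : 'rV[R]_n).

Definition bilin A u v : R := (u *m A *m v^T) 0 0.

Lemma bilinDl A u v w : bilin A (u + v) w = bilin A u w + bilin A v w.
Proof. by rewrite /bilin !mulmxDl mxE. Qed.

Lemma bilinDr A u v w : bilin A w (u + v) = bilin A w u + bilin A w v.
Proof. by rewrite /bilin linearD /= mulmxDr mxE. Qed.

Lemma bilinZl A a u v : bilin A (a *: u) v = a * bilin A u v.
Proof. by rewrite /bilin -!scalemxAl mxE. Qed.

Lemma bilinZr A a u v : bilin A u (a *: v) = a * bilin A u v.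
Proof. by rewrite /bilin linearZ /= -scalemxAr mxE. Qed.

Lemma bilinNl A u v : bilin A (- u) v = - bilin A u v.
Proof. by rewrite -scaleN1r bilinZl mulN1r. Qed.

Lemma bilinNr A u v : bilin A u (- v) = - bilin A u v.
Proof. by rewrite -scaleN1r bilinZr mulN1r. Qed.

Lemma bilin_sym A u v : A^T = A -> bilin A u v = bilin A v u.
Proof.
move=> As; rewrite /bilin; transitivity ((u *m A *m v^T)^T 0 0).
  by rewrite [RHS]mxE.
by rewrite !trmx_mul trmxK As mulmxA.
Qed.

Lemma bilinE A u v : bilin A u v = \sum_i \sum_j u 0 i * A i j * v 0 j.
Proof.
rewrite /bilin mxE exchange_big; apply: eq_bigr => j _ /=.
by rewrite !mxE big_distrl.
Qed.

Lemma bilinDM A B u v : bilin (A + B) u v = bilin A u v + bilin B u v.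
Proof. by rewrite /bilin mulmxDr mulmxDl mxE. Qed.

Lemma bilinBM A B u v : bilin (A - B) u v = bilin A u v - bilin B u v.
Proof. by rewrite /bilin mulmxBr mulmxBl !mxE. Qed.

Lemma bilinZM a A u v : bilin (a *: A) u v = a * bilin A u v.
Proof. by rewrite /bilin -scalemxAr -scalemxAl mxE. Qed.

Lemma bilin_sumM (I : Type) (r : seq I) (P : pred I) (F : I -> 'M[R]_n) u v :
  bilin (\sum_(i <- r | P i) F i) u v = \sum_(i <- r | P i) bilin (F i) u v.
Proof. by rewrite /bilin mulmx_sumr mulmx_suml summxE. Qed.

Lemma bilin1 u v : bilin 1%:M u v = \sum_i u 0 i * v 0 i.
Proof. by rewrite /bilin mulmx1 mxE; under eq_bigr do rewrite mxE. Qed.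

(** Writes a sum of squares of linear functionals as a quadratic form, which makes it visibly
    nonnegative. *)
Lemma bilin_gram m (L : 'M[R]_(n, m)) u :
  bilin (L *m L^T) u u = \sum_i (u *m L) 0 i ^+ 2.
Proof.
rewrite /bilin mulmxA -mulmxA -trmx_mul mxE.
by apply: eq_bigr => i _; rewrite expr2 [X in _ * X = _]mxE.
Qed.

End bilinear.

(** * Penalized least squares over a subspace *)

Section least_squares.
Variables (R : realFieldType) (n : nat).
Implicit Types (B S : 'M[R]_n) (f u v : 'rV[R]_n).

Lemma quad_ge0_lin_eq0 (b c : R) :
  0 <= c -> (forall t, 0 <= 2 * t * b + t ^+ 2 * c) -> b = 0.
Proof.
(* The exact minimizer would be [- b / c]; the shift to [c + 1] also covers [c = 0] and still gives
   a negative value unless [b = 0]. *)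
move=> c0 /(_ (- b / (c + 1))).
have c1 : c + 1 != 0 by rewrite gt_eqF// ltr_wpDl.
have -> : 2 * (- b / (c + 1)) * b + (- b / (c + 1)) ^+ 2 * c
  = - ((c + 2) * (b / (c + 1)) ^+ 2) by field.
rewrite oppr_ge0 pmulr_rle0; last by rewrite ltr_wpDl.
by rewrite le_eqVlt ltNge sqr_ge0 orbF sqrf_eq0 mulf_eq0 invr_eq0 (negPf c1) orbF => /eqP.
Qed.

(** Polarization: evaluating at the sum of the [i]-th and [j]-th basis vectors leaves twice the
    entry [S i j]. *)
Lemma quadratic_form_eq0 (S : 'M[R]_n) :
  S^T = S -> (forall u, bilin S u u = 0) -> S = 0.
Proof.
move=> Ss S0; apply/matrixP => i j; rewrite mxE.
have := S0 (delta_mx 0 i + delta_mx 0 j).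
rewrite !(bilinDl, bilinDr) !S0 add0r addr0 [X in _ + X]bilin_sym//.
rewrite /bilin -rowE trmx_delta -colE !mxE.
by move/eqP; rewrite -mulr2n mulrn_eq0 => /eqP.
Qed.

Definition penalized_sqdist B f u := bilin 1%:M (u - f) (u - f) + bilin B u u.

(** In coordinates on a basis [V] of [W], the normal equations have the invertible Gram matrix of
    [1 + B]. Solving them gives a matrix [S] that depends on [W] and [B] but not on [f]. *)
Lemma penalized_least_squares m (W : 'M[R]_(m, n)) B :
  B^T = B -> (forall u, 0 <= bilin B u u) ->
  exists2 S : 'M[R]_n, S^T = S &
    forall f u, (u <= W)%MS ->
      (forall v, (v <= W)%MS ->
        penalized_sqdist B f u <= penalized_sqdist B f v) ->
      u = f *m S /\
      penalized_sqdist B f u = bilin 1%:M f f - bilin S f f.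
Proof.
move=> Bs B0.
have I0 u : 0 <= bilin 1%:M u u.
  by rewrite bilin1 sumr_ge0// => i _; rewrite -expr2 sqr_ge0.
have Ieq0 u : bilin 1%:M u u = 0 -> u = 0.
  rewrite bilin1 => /psumr_eq0P u0; apply/rowP => i; rewrite mxE.
  apply/eqP; rewrite -sqrf_eq0 expr2 u0// => j _.
  by rewrite -expr2 sqr_ge0.
have Is : (1%:M : 'M[R]_n)^T = 1%:M by rewrite trmx1.
have [r [V [Vfree VW]]] : exists r (V : 'M[R]_(r, n)), row_free V /\ (V :=: W)%MS.
  exists (\rank W), (row_base W); split; last exact: eq_row_base.
  exact: row_base_free.
pose C := 1%:M + B; pose M := V *m C *m V^T.
have Cs : C^T = C by rewrite linearD /= Is Bs.
have Ms : M^T = M by rewrite !trmx_mul trmxK Cs mulmxA.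
(* If [x *m M = 0], the form [C] vanishes at [x *m V]; since [C] dominates the identity form,
   [x *m V = 0], and [x = 0] because [V] is free. *)
have Mu : M \in unitmx.
  rewrite -row_free_unit -kermx_eq0; apply/eqP/row_matrixP => i; rewrite row0.
  set x := row i _; have xM : x *m M = 0.
    by apply/eqP; rewrite -sub_kermx row_sub.
  have : bilin C (x *m V) (x *m V) = 0.
    transitivity ((x *m M *m x^T) 0 0); last by rewrite xM mul0mx mxE.
    by rewrite /bilin /M trmx_mul !mulmxA.
  rewrite bilinDM => /eqP; rewrite paddr_eq0// => /andP[/eqP/Ieq0 xV _].
  apply/eqP; rewrite -(mulmx_free_eq0 _ Vfree); exact/eqP.
exists (V^T *m invmx M *m V).
  by rewrite !trmx_mul trmxK trmx_inv Ms mulmxA.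
move=> f u uW umin.
(* First variation: the energy at [u + t *: w], minus that at [u], is a nonnegative quadratic in [t]
   without constant term, so its linear coefficient vanishes. *)
have normal w : (w <= W)%MS -> bilin C u w = bilin 1%:M f w.
  move=> wW; apply/eqP; rewrite -subr_eq0; apply/eqP.
  apply: (@quad_ge0_lin_eq0 _ (bilin C w w)).
    by rewrite bilinDM addr_ge0.
  move=> t; have := umin (u + t *: w) (addmx_sub uW (scalemx_sub t wW)).
  rewrite -subr_ge0 /penalized_sqdist !bilinDM.
  rewrite !(bilinDl, bilinDr, bilinNl, bilinNr, bilinZl, bilinZr).
  rewrite (bilin_sym w u Is) (bilin_sym w f Is) (bilin_sym u f Is).
  rewrite (bilin_sym w u Bs) => h; apply: le_trans h _.
  by rewrite le_eqVlt; apply/orP; left; apply/eqP; ring.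
have uE : u = f *m (V^T *m invmx M *m V).
  move: uW; rewrite -VW => /submxP[x ux].
  have : x *m M = f *m V^T.
    apply/rowP => j; have := normal (row j V).
    rewrite (submx_trans (row_sub _ _)) ?VW// => /(_ isT).
    have bilin_row A y : bilin A y (row j V) = (y *m A *m V^T) 0 j.
      by rewrite /bilin !mxE; apply: eq_bigr => i _; rewrite !mxE.
    by rewrite !bilin_row mulmx1 ux /M !mulmxA.
  move/(congr1 (mulmx^~ (invmx M))); rewrite mulmxK// => xE.
  by rewrite ux xE !mulmxA.
(* Testing the normal equations with [u] itself reduces the energy to the squared norm of [f] minus
   the inner product of [f] and [u]. *)
split=> //; have uu : bilin C u u = bilin 1%:M f u.
  exact: normal.
rewrite /penalized_sqdist !(bilinDl, bilinDr, bilinNl, bilinNr).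
rewrite (bilin_sym u f Is).
have -> : bilin (V^T *m invmx M *m V) f f = bilin 1%:M f u.
  by rewrite [RHS]bilin_sym// uE /bilin mulmx1.
by rewrite -uu bilinDM; ring.
Qed.

End least_squares.

(** * Zero sets of separately polynomial functions *)

Section separately_polynomial.
Variable R : realType.

Definition tuple_set n (t : n.-tuple R) (i : 'I_n) (x : R) : n.-tuple R :=
  [tuple if j == i then x else tnth t j | j < n].

(** This coordinatewise condition passes to the sections obtained by freezing the first coordinate,
    as induction on the dimension requires. *)
Definition separately_polynomial n (h : n.-tuple R -> R) : Prop :=
  forall t i, exists p : {poly R}, forall x, h (tuple_set t i x) = p.[x].

Lemma tuple_set_cons_pair0 n (x y : R) (t : n.-tuple R) :
  tuple_set (cons_pair (y, t)) ord0 x = cons_pair (x, t).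
Proof.
apply: eq_from_tnth => i; rewrite tnth_mktuple.
have [j ->|->] := unliftP ord0 i; rewrite ?eqxx ?tnthS//.
Qed.

Lemma tuple_set_cons_pairS n (x y : R) (t : n.-tuple R) i :
  tuple_set (cons_pair (y, t)) (lift ord0 i) x = cons_pair (y, tuple_set t i x).
Proof.
apply: eq_from_tnth => j; rewrite tnth_mktuple.
have [l ->|->] := unliftP ord0 j; rewrite ?tnthS ?tnth_mktuple//.
Qed.

Lemma cons_pair_eta n (t : n.+1.-tuple R) :
  cons_pair (thead t, [tuple of behead t]) = t.
Proof. by rewrite [RHS]tuple_eta; exact/val_inj. Qed.

(* By Fubini: [h (x, g0)] is a nonzero polynomial in [x] for some [g0], so for all
   but finitely many [x] the section [h (x, _)] is not identically zero. *)
Lemma separately_polynomial_zeros_null n (h : n.-tuple R -> R) t0 :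
  measurable_fun setT h -> separately_polynomial h -> h t0 != 0 ->
  lebesgue_tuple [set t | h t = 0]%classic = 0%E.
Proof.
elim: n h t0 => [|n IHn] h t0 mh hpoly h0.
  rewrite /= diracE memNset// => /= h00; move: h0.
  by rewrite (tuple0 t0) h00 eqxx.
pose x0 := thead t0; pose g0 : n.-tuple R := [tuple of behead t0].
have [p pE] := hpoly (cons_pair (x0, g0)) ord0.
have p_neq0 : p != 0.
  apply: contra_neq h0 => p0.
  by rewrite -(cons_pair_eta t0) -(tuple_set_cons_pair0 _ x0) pE p0 horner0.
pose A := [set xt : measurableTypeR R * n.-tuple R | h (cons_pair xt) = 0]%classic.
have mc := @measurable_cons_pair R n.
have mA : measurable A.
  rewrite -[A]setTI; have := measurableT_comp mh mc measurableT.
  move=> /(_ [set 0]%classic (measurable_set1 _)); exact.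
have secE x : xsection A x = [set t | h (cons_pair (x, t)) = 0]%classic.
  by apply/seteqP; split => t; rewrite /xsection/= inE.
(* The pushforward along [cons_pair] unfolds to the product measure of the preimage [A]. *)
change ((@lebesgue_measure R \x @lebesgue_tuple R n)%E A = 0%E).
have mphi := measurable_fun_xsection (@lebesgue_tuple R n) mA.
pose D := [set x : measurableTypeR R | root p x]%classic.
have finD : finite_set D.
  apply: contrapT => /(infinite_set_fset (size p))[B BD].
  apply/negP; rewrite -ltnNge; apply: max_poly_roots => //.
    by apply/allP => x /BD.
  exact: finmap.fset_uniq.
have D0 : @lebesgue_measure R D = 0%E.
  by apply: countable_lebesgue_measure0; exact: finite_set_countable.
have mD : measurable D.
  apply: countable_measurable; first by move=> x; exact: measurable_set1.
  exact: finite_set_countable.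
(* The product measure is the integral of the measures of the sections; removing the null set [D]
   leaves only [x] with [p.[x] != 0], whose sections are null by induction, with [g0] as nonzero
   point. *)
apply: (etrans (ge0_negligible_integral mD measurableT mphi _ D0)) => //.
apply: integral0_eq => x [_ /= Dx]; rewrite secE.
apply: (IHn (fun t => h (cons_pair (x, t))) g0).
+ apply: measurableT_comp => //.
  apply: (measurableT_comp mc); exact: measurable_fun_pair.
+ move=> t i; have [q qE] := hpoly (cons_pair (x, t)) (lift ord0 i).
  by exists q => y; rewrite -tuple_set_cons_pairS.
+ by apply/eqP => hx; apply: Dx; apply/rootP; rewrite -pE tuple_set_cons_pair0.
Qed.

End separately_polynomial.

(** * Level sets of quadratic forms on tuples *)

Definition row_of_tuple (R : Type) n (t : n.-tuple R) : 'rV[R]_n :=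
  \row_i tnth t i.

Definition tuple_of_row (R : Type) n (u : 'rV[R]_n) : n.-tuple R :=
  [tuple u 0 i | i < n].

Lemma tuple_of_rowK (R : Type) n :
  cancel (@tuple_of_row R n) (@row_of_tuple R n).
Proof. by move=> u; apply/rowP => i; rewrite mxE tnth_mktuple. Qed.

Lemma row_of_tupleK (R : Type) n :
  cancel (@row_of_tuple R n) (@tuple_of_row R n).
Proof. by move=> t; apply: eq_from_tnth => i; rewrite tnth_mktuple mxE. Qed.

Section quadratic_level_set.
Variables (R : realType) (n : nat) (A : 'M[R]_n) (c : R).

Let h (t : n.-tuple R) := bilin A (row_of_tuple t) (row_of_tuple t) - c.

Let measurable_h : measurable_fun setT h.
Proof.
apply: measurable_funB => //; under eq_fun do rewrite bilinE.
apply: measurable_sum => i; apply: measurable_sum => j.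
under eq_fun do rewrite !mxE.
by do 2?apply: measurable_funM => //; exact: measurable_tnth.
Qed.

Let separately_polynomial_h : separately_polynomial h.
Proof.
move=> t i; pose q j : {poly R} := if j == i then 'X else (tnth t j)%:P.
exists (\sum_j \sum_l q j * (A j l)%:P * q l - c%:P) => x.
have qE j : (q j).[x] = tnth (tuple_set t i x) j.
  by rewrite tnth_mktuple /q; case: ifP; rewrite ?hornerX ?hornerC.
rewrite /h bilinE !hornerE horner_sum; congr (_ - _).
apply: eq_bigr => j _; rewrite horner_sum; apply: eq_bigr => l _.
by rewrite !hornerE !qE !mxE.
Qed.

Lemma quadratic_level_set_null : A^T = A -> A != 0 ->
  \forall t \ae (@lebesgue_tuple R n),
    bilin A (row_of_tuple t) (row_of_tuple t) != c.
Proof.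
move=> As A0.
have [u hu] : exists u : 'rV[R]_n, h (tuple_of_row u) != 0.
  apply: contrapT => /forallNP hN; move/negP: A0; apply; apply/eqP.
  (* If [h] vanished everywhere, the form would be constant, hence equal to its value 0 at the
     origin, and polarization would give [A = 0]. *)
  have hc u : bilin A u u = c.
    have /negP/negPn := hN u.
    by rewrite /h tuple_of_rowK subr_eq0 => /eqP.
  apply: quadratic_form_eq0 => // u; rewrite hc -(hc 0).
  by rewrite /bilin mul0mx mul0mx mxE.
exists [set t | h t = 0]%classic; split.
- rewrite -[X in measurable X]setTI.
  by have := measurable_h measurableT (measurable_set1 0); exact.
- exact: separately_polynomial_zeros_null hu.
- by move=> t /= /negP/negPn/eqP bt; rewrite /h bt subrr.
Qed.

End quadratic_level_set.

(** * Both problems for a fixed partition as penalized least squares *)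

Section problems_as_least_squares.
Variables (R : realType) (N k : nat).
Implicit Types (f u v : N.-tuple R) (I : {set 'I_N}) (P Q : {set {set 'I_N}}).

Lemma sqdistE u f : sqdist u f =
  bilin 1%:M (row_of_tuple u - row_of_tuple f) (row_of_tuple u - row_of_tuple f).
Proof. by rewrite bilin1; apply: eq_bigr => i _; rewrite !mxE expr2. Qed.

Let unit_tuple (n : 'I_N) : N.-tuple R := [tuple (i == n)%:R | i < N].

(** Linearity in [u] of reading an entry of a subvector; past the end both sides are the default
    0. *)
Lemma nth_tuple_seq_sum u (s : seq 'I_N) m :
  [seq tnth u i | i <- s]`_m =
  \sum_n tnth u n * [seq tnth (unit_tuple n) i | i <- s]`_m.
Proof.
elim: s m => [|a s IHs] [|m] //=; try by rewrite big1// => n _; rewrite mulr0.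
rewrite (bigD1 a)//= tnth_mktuple eqxx mulr1 big1 ?addr0// => n na.
by rewrite tnth_mktuple eq_sym (negPf na) mulr0.
Qed.

(** The finite difference of the subvector is linear in [u]. Row [n] of its matrix [L] is the image
    of the [n]-th unit vector, and [B] is the Gram matrix of [L]. *)
Lemma sqnorm_fdiff_quadratic I : exists B : 'M[R]_N,
  [/\ B^T = B, forall w, 0 <= bilin B w w &
    forall u, sqnorm (fdiff k (subvec u I)) =
              bilin B (row_of_tuple u) (row_of_tuple u)].
Proof.
pose L : 'M[R]_(N, size (enum I) - k) :=
  \matrix_(n, i) \sum_(j < k.+1)
    (-1) ^+ (k - j) * 'C(k, j)%:R * (subvec (unit_tuple n) I)`_(i + j).
exists (L *m L^T); split.
- by rewrite trmx_mul trmxK.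
- by move=> u; rewrite bilin_gram sumr_ge0// => i _; exact: sqr_ge0.
move=> u; rewrite bilin_gram /sqnorm /fdiff size_map /mkseq big_map.
rewrite -[in iota 0 _](subn0 (_ - _)%N) -/(index_iota 0 _) big_mkord.
apply: eq_bigr => i _; congr (_ ^+ 2); rewrite mxE.
under [RHS]eq_bigr do rewrite !mxE big_distrr/=.
rewrite exchange_big; apply: eq_bigr => j _ /=.
rewrite {1}/subvec nth_tuple_seq_sum big_distrr; apply: eq_bigr => n _ /=.
by rewrite mulrCA.
Qed.

Lemma mumford_shah_penalized beta gamma P : exists B : 'M[R]_N,
  [/\ B^T = B, forall w, 0 <= bilin B w w &
    forall f u, mumford_shah k beta gamma f u P =
      penalized_sqdist B (row_of_tuple f) (row_of_tuple u) + gamma * #|P|%:R].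
Proof.
have [B_ BP] := choice sqnorm_fdiff_quadratic.
exists (\sum_(I in P) beta ^+ (2 * k) *: B_ I); split.
- rewrite linear_sum; apply: eq_bigr => I _ /=.
  by rewrite linearZ/=; have [-> _ _] := BP I.
- move=> u; rewrite bilin_sumM sumr_ge0// => I _; rewrite bilinZM.
  have [_ BI0 _] := BP I.
  by rewrite mulr_ge0// exprM exprn_ge0// sqr_ge0.
- move=> f u; rewrite /mumford_shah /penalized_sqdist sqdistE bilin_sumM.
  congr (_ + _ + _); apply: eq_bigr => I _.
  by rewrite bilinZM; have [_ _ ->] := BP I.
Qed.

(** The row space consists of the polynomials of degree below [k] on [I], extended by zero; [n.+1]
    is the point of index [n]. *)
Definition monomials_on I : 'M[R]_(k, N) :=
  \matrix_(j, n) ((n \in I)%:R * n.+1%:R ^+ j).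

Lemma sum_partition_mem P (n : 'I_N) I (F : {set 'I_N} -> R) :
  finset.partition P [set: 'I_N]%SET -> I \in P -> n \in I ->
  \sum_(J in P) (n \in J)%:R * F J = F I.
Proof.
move=> /and3P[_ tP _] IP nI; rewrite (bigD1 I)//= nI mul1r.
rewrite big1 ?addr0// => J /andP[JP JI]; case: (boolP (n \in J)) => nJ.
  by move: JI; rewrite -(finset.def_pblock tP JP nJ) (finset.def_pblock tP IP nI) eqxx.
by rewrite mul0r.
Qed.

(** A signal is the sum of its restrictions to the blocks, and the coefficients of a polynomial on a
    block are exactly the coordinates along the rows of [monomials_on]. *)
Lemma potts_feasibleE u P : interval_partition P ->
  potts_feasible k u P <->
  (row_of_tuple u <= \sum_(I in P) <<monomials_on I>>)%MS.
Proof.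
move=> HP; have [partP _] := HP.
split=> [[_ uP]|/sub_sumsmxP[w uE]].
  have -> : row_of_tuple u =
      \sum_(I in P) \row_n ((n \in I)%:R * tnth u n).
    apply/rowP => n; rewrite mxE summxE.
    have nP : n \in finset.cover P by rewrite (cover_partition partP) finset.in_setT.
    have nI : n \in finset.pblock P n by rewrite finset.mem_pblock.
    under eq_bigr do rewrite mxE.
    by rewrite (sum_partition_mem (fun=> _) partP (finset.pblock_mem nP) nI).
  apply: summx_sub_sums => I IP; have [p pk pE] := uP _ IP.
  rewrite genmxE; apply/submxP; exists (poly_rV p); apply/rowP => n; rewrite !mxE.
  under eq_bigr do rewrite !mxE mulrCA.
  rewrite -big_distrr/=; case: (boolP (n \in I)) => nI; last by rewrite !mul0r.
  by rewrite !mul1r pE// (horner_coef_wide _ pk).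
have /choice[c wE] I : exists c, w I *m <<monomials_on I>>%MS = c *m monomials_on I.
  by apply/submxP; rewrite (submx_trans (submxMl _ _))// genmxE.
split=> // I IP; exists (rVpoly (c I)); first exact: size_poly.
move=> n nI; rewrite (horner_coef_wide _ (size_poly _ _)).
have /rowP/(_ n) := uE; rewrite mxE summxE => ->.
rewrite -(sum_partition_mem
  (fun J => \sum_(j < k) (rVpoly (c J))`_j * n.+1%:R ^+ j) partP IP nI).
apply: eq_bigr => J _; rewrite wE mxE big_distrr; apply: eq_bigr => j _ /=.
by rewrite mxE coef_rVpoly_ord mulrCA.
Qed.

Lemma potts_penalized gamma f u P : potts gamma f u P =
  penalized_sqdist 0 (row_of_tuple f) (row_of_tuple u) + gamma * #|P|%:R.
Proof.
rewrite /potts /penalized_sqdist sqdistE.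
by rewrite [bilin 0 _ _]/bilin mulmx0 mul0mx mxE addr0.
Qed.

Definition energy (beta : \bar R) gamma f u P : R :=
  if beta is b%:E then mumford_shah k b gamma f u P else potts gamma f u P.

Lemma minimizer_energy_le beta gamma f u v P Q :
  minimizer k beta gamma f u P -> minimizer k beta gamma f v Q ->
  energy beta gamma f u P <= energy beta gamma f v Q.
Proof. by case: beta => [b||] //= [_ uP] [vQ _]; exact: uP. Qed.

(** For finite [beta] the subspace is everything and the penalty is the difference term; for [+oo]
    the penalty is 0 and the subspace is that of the feasible signals. *)
Lemma minimizer_linear beta gamma P : exists2 S : 'M[R]_N, S^T = S &
  forall f u, minimizer k beta gamma f u P ->
    row_of_tuple u = row_of_tuple f *m S /\
    energy beta gamma f u P =
      bilin 1%:M (row_of_tuple f) (row_of_tuple f)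
      - bilin S (row_of_tuple f) (row_of_tuple f) + gamma * #|P|%:R.
Proof.
case: beta => [b||]/=.
- have [B [Bs B0 BE]] := mumford_shah_penalized b gamma P.
  have [S Ss SP] := penalized_least_squares (1%:M : 'M[R]_N) Bs B0.
  exists S => // f u [HP umin].
  have [] := SP (row_of_tuple f) (row_of_tuple u) (submx1 _).
    move=> v _; have := umin (tuple_of_row v) P HP.
    by rewrite !BE tuple_of_rowK lerD2r.
  by rewrite BE => -> ->.
- have B0 w : 0 <= bilin (0 : 'M[R]_N) w w.
    by rewrite /bilin mulmx0 mul0mx mxE.
  have [S Ss SP] := penalized_least_squares
    (\sum_(I in P) <<monomials_on I>>)%MS (trmx0 _ _ _) B0.
  exists S => // f u [uP umin]; have HP := uP.1.
  have [] := SP (row_of_tuple f) (row_of_tuple u).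
  + exact/potts_feasibleE.
  + move=> v vP; have := umin (tuple_of_row v) P.
    rewrite !potts_penalized tuple_of_rowK lerD2r; apply.
    by apply/potts_feasibleE => //; rewrite tuple_of_rowK.
  by rewrite potts_penalized => -> ->.
- by exists 0; rewrite ?trmx0.
Qed.

End problems_as_least_squares.

(** * Uniqueness of the minimizing signal for almost all data *)

Unset Implicit Arguments.

Theorem theorem5 (R : realType) (N k : nat) (gamma : R) (beta : \bar R)
    (hk : (1 <= k)%N) (hgamma : 0 < gamma) (hbeta : (0 < beta)%E) :
  \forall f \ae (@lebesgue_tuple R N),
    forall (u v : N.-tuple R) (I J : {set {set 'I_N}}),
      minimizer k beta gamma f u I -> minimizer k beta gamma f v J -> u = v.
Proof.
have pairwise (IJ : {set {set 'I_N}} * {set {set 'I_N}}) :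
    \forall f \ae (@lebesgue_tuple R N), forall u v : N.-tuple R,
      minimizer k beta gamma f u IJ.1 -> minimizer k beta gamma f v IJ.2 ->
      u = v.
  case: IJ => I J /=.
  have [S Ss SI] := minimizer_linear k beta gamma I.
  have [T Ts TJ] := minimizer_linear k beta gamma J.
  have [ST|ST] := eqVneq S T.
    apply: nearW => f u v /SI[uE _] /TJ[vE _].
    by apply: (can_inj (@row_of_tupleK _ _)); rewrite uE vE ST.
  have STs : (S - T)^T = S - T by rewrite linearB/= Ss Ts.
  have ST0 : S - T != 0 by rewrite subr_eq0.
  (* This level is the value that equality of the two optimal energies forces on the form of [S - T]
     at [f]. *)
  have := quadratic_level_set_null (gamma * #|I|%:R - gamma * #|J|%:R) STs ST0.
  apply: filterS => f /eqP fST u v mu mv; exfalso; apply: fST.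
  have : energy k beta gamma f u I = energy k beta gamma f v J.
    by apply/le_anti; rewrite !minimizer_energy_le.
  have [_ ->] := SI _ _ mu; have [_ ->] := TJ _ _ mv.
  by rewrite bilinBM; lra.
(* Pairs of partitions form a finite type, so the almost-everywhere statements hold
   simultaneously. *)
apply: filterS (filter_forall _ pairwise) => f fP u v I J.
exact: (fP (I, J)).
Qed.
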